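(* Let $N\ge 3$, $1<p<\infty$, $m>1$, and let $\Omega\subset\mathbb{R}^N$ be a bounded domain whose singularity at the origin is of the form $\big(\sum_{i=2}^N x_i^2\big)^{1/2}<x_1^m$, i.e. there is $\delta>0$ such that $$\Omega\cap B_\delta(0)=\Big\{x\in\mathbb{R}^N:\ x_1>0,\ \Big(\sum_{i=2}^N x_i^2\Big)^{1/2}<x_1^m\Big\}\cap B_\delta(0).$$ Let $$\alpha\in\left(\frac{-1-m(N-1)}{p},\ \frac{-1-m(N-1)}{p}+m-1\right]$$ and let $f\in\overline{L^p(\Omega)}$ satisfy $f(x_1,x_2,\dots,x_N)\simeq x_1^\alpha$ near the origin. Then there is no $\mathbf{u}\in (W^{1,p}_0(\Omega))^N$ with $\operatorname{div}\mathbf{u}=f$ a.e. in $\Omega$.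
   Context: $B_\delta(0)$ is the open ball of radius $\delta$ centered at the origin. $\overline{L^p(\Omega)}:=\{f\in L^p(\Omega):\int_\Omega f\,dx=0\}$. $W^{1,p}_0(\Omega)$ is the closure of the smooth functions compactly supported in $\Omega$ in the $W^{1,p}$ norm. The notation $f(x)\simeq\psi(x_1)$ near the origin, for a positive function $\psi$ on a right neighborhood of $0$, means that the ratio $f(x)/\psi(x_1)$ has an (essential) limit in $(0,\infty)$ as $x\to0$ in $\Omega$: there is $c\in(0,\infty)$ such that for every $\varepsilon>0$ there is $\eta>0$ with $|f(x)/\psi(x_1)-c|\le\varepsilon$ for a.e. $x\in\Omega\cap B_\eta(0)$. *)

(* Defs.v *)
From HB Require Import structures.
From mathcomp Require Import all_boot all_order all_algebra.
From mathcomp Require Import all_classical all_reals all_analysis.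
Set Implicit Arguments.
Unset Strict Implicit.
Unset Printing Implicit Defensive.
Import Order.TTheory GRing.Theory Num.Theory.
Import numFieldNormedType.Exports.
Local Open Scope classical_set_scope.
Local Open Scope ring_scope.

Section measurable_rV.
Context {R : realType}.
Variable n : nat.

Definition rV_coor (i : 'I_n) (x : 'rV[R]_n) : measurableTypeR R := x ord0 i.

Definition measurable_rV_display : measure_display.
Proof. exact: default_measure_display. Qed.

Let rV_set0 : g_sigma_preimage rV_coor set0.
Proof. exact: sigma_algebra0. Qed.

Let rV_setC A : g_sigma_preimage rV_coor A -> g_sigma_preimage rV_coor (~` A).
Proof. exact: sigma_algebraC. Qed.

Let rV_bigcup (F : (set _)^nat) : (forall i, g_sigma_preimage rV_coor (F i)) ->
  g_sigma_preimage rV_coor (\bigcup_i (F i)).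
Proof. exact: sigma_algebra_bigcup. Qed.

(* The product sigma-algebra generated by the coordinates, i.e. the Borel
   sigma-algebra of R^n. *)
HB.instance Definition _ := @isMeasurable.Build measurable_rV_display
  'rV[R]_n (g_sigma_preimage rV_coor) rV_set0 rV_setC rV_bigcup.

End measurable_rV.

Section measurable_rV_cons.
Context {R : realType}.

Lemma measurable_fun_rVP d (T : measurableType d) n (f : T -> 'rV[R]_n) :
  (forall i, measurable_fun [set: T] (rV_coor i \o f)) ->
  measurable_fun [set: T] f.
Proof.
move=> mf _ A mA; rewrite setTI.
suff : g_sigma_preimage (@rV_coor R n) `<=` [set A | measurable (f @^-1` A)].
  exact.
apply: smallest_sub; first split => /=.
- by rewrite preimage_set0.
- by move=> B mB; rewrite setTD preimage_setC; exact: measurableC.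
- by move=> F mF; rewrite preimage_bigcup; exact: bigcupT_measurable.
case: n => [|n] in f mf A mA *; first by rewrite big_ord0.
rewrite -bigcup_mkord_ord; apply: bigcup_sub => i Ii.
by move=> B [C mC <-] /=; rewrite setTI -[X in measurable X]setTI; exact: mf.
Qed.

Lemma measurable_rV_coor n (i : 'I_n) :
  measurable_fun [set: 'rV[R]_n] (rV_coor i).
Proof.
move=> _ Y mY; rewrite setTI; apply: sub_sigma_algebra => /=.
rewrite -bigcup_seq/=; exists i => /=; first by rewrite mem_index_enum.
by exists Y => //; rewrite setTI.
Qed.

Definition rV_cons n (xy : measurableTypeR R * 'rV[R]_n) : 'rV[R]_n.+1 :=
  \row_i oapp (xy.2 ord0) xy.1 (unlift ord0 i).

Lemma measurable_rV_cons n : measurable_fun setT (@rV_cons n).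
Proof.
apply: measurable_fun_rVP => i.
case: (unliftP ord0 i) => [j|] ->.
  rewrite (_ : _ \o _ = rV_coor j \o snd).
    by apply: measurableT_comp => //; exact: measurable_rV_coor.
  by apply/funext => -[x y]; rewrite /rV_coor /= mxE liftK.
rewrite (_ : _ \o _ = fst) //.
by apply/funext => -[x y]; rewrite /rV_coor /= mxE unlift_none.
Qed.

Definition rV_uncons n (z : 'rV[R]_n.+1) : measurableTypeR R * 'rV[R]_n :=
  (z ord0 ord0, \row_j z ord0 (lift ord0 j)).

Lemma rV_consK n : cancel (@rV_cons n) (@rV_uncons n).
Proof.
move=> [x y]; congr pair; rewrite ?mxE ?unlift_none//.
by apply/rowP => j; rewrite !mxE liftK.
Qed.

Lemma measurable_rV_uncons n : measurable_fun setT (@rV_uncons n).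
Proof.
apply/measurable_fun_pairP; split; first exact: measurable_rV_coor.
apply: measurable_fun_rVP => j.
rewrite (_ : _ \o _ = rV_coor (lift ord0 j)); first exact: measurable_rV_coor.
by apply/funext => z; rewrite /rV_coor /= mxE.
Qed.

End measurable_rV_cons.

Section lebesgue_measure_rV.
Context {R : realType}.

Section step.
Variables (n : nat) (mu : {sigma_finite_measure set 'rV[R]_n -> \bar R}).

Definition lebesgue_rV_step : set 'rV[R]_n.+1 -> \bar R :=
  pushforward (@lebesgue_measure R \x mu)%E (@rV_cons R n).

HB.instance Definition _ := Measure.copy lebesgue_rV_step
  (measure_function_pushforward__canonical__measure_function_Measure
    (@lebesgue_measure R \x mu)%E (@measurable_rV_cons R n)).

Let step_sigma_finite : sigma_finite setT lebesgue_rV_step.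
Proof.
have /sigma_finiteP[F [TF ndF Foo]] := sigma_finiteT (@lebesgue_measure R).
have /sigma_finiteP[G [TG ndG Goo]] := sigma_finiteT mu.
exists (fun i => @rV_uncons R n @^-1` (F i `*` G i)).
  apply/seteqP; split => // z _.
  have [i _ Fi] : (\bigcup_i F i) (rV_uncons z).1 by rewrite -TF.
  have [j _ Gj] : (\bigcup_i G i) (rV_uncons z).2 by rewrite -TG.
  exists (maxn i j) => //; split.
  - by move: Fi; exact/subsetPset/ndF/leq_maxl.
  - by move: Gj; exact/subsetPset/ndG/leq_maxr.
move=> i; have [mF Fi] := Foo i; have [mG Gi] := Goo i; split.
  rewrite -[X in measurable X]setTI; apply: measurable_rV_uncons => //.
  exact: measurableX.
rewrite /lebesgue_rV_step /pushforward -comp_preimage.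
rewrite (_ : _ \o _ = id); last by apply/funext => x; exact: rV_consK.
rewrite preimage_id.
by rewrite product_measure1E// lte_mul_pinfty// ge0_fin_numE.
Qed.

HB.instance Definition _ := Measure_isSigmaFinite.Build _ _ _
  lebesgue_rV_step step_sigma_finite.

End step.

(* n-dimensional Lebesgue measure, by recursion on the dimension: the image of
   the product of the one-dimensional measure with the (n-1)-dimensional one
   under the identification of R * R^(n-1) with R^n. *)
Fixpoint lebesgue_rV (n : nat) : {sigma_finite_measure set 'rV[R]_n -> \bar R} :=
  match n with
  | 0 => \d_(0 : 'rV[R]_0)
  | k.+1 => lebesgue_rV_step (lebesgue_rV k)
  end.

End lebesgue_measure_rV.

Section sobolev.
Context {R : realType} {n : nat}.
Local Notation V := 'rV[R]_n.+1.
Local Notation leb := (@lebesgue_rV R n.+1).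
Implicit Types (p : R) (Omega : set V) (f g u phi : V -> R)
  (G : 'I_n.+1 -> V -> R) (i : 'I_n.+1).

(* The library norm on row vectors is the sup norm. *)
Definition euclid_norm (x : V) : R := Num.sqrt (\sum_i x ord0 i ^+ 2).

Definition euclid_ball0 (r : R) : set V := [set x | euclid_norm x < r].

Definition domain Omega := open Omega /\ connected Omega.

Definition Lp Omega p f := f \_ Omega \in Lfun leb p%:E.

Definition Lp_mean0 Omega p f :=
  Lp Omega p f /\ (\int[leb]_(x in Omega) (f x)%:E = 0)%E.

Definition partial i phi : V -> R := fun x => 'D_(delta_mx ord0 i) phi x.

Fixpoint Ck (k : nat) phi : Prop :=
  if k is k'.+1 then
    continuous phi /\
    forall i, (forall x, derivable phi x (delta_mx ord0 i)) /\
              Ck k' (partial i phi)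
  else continuous phi.

Definition smooth phi := forall k, Ck k phi.

(* C_c^oo(Omega), each function being extended by 0 outside Omega *)
Definition test_function Omega phi :=
  let supp := closure [set x | phi x != 0] in
  [/\ smooth phi, compact supp & supp `<=` Omega].

Definition weak_partial Omega i u g := forall phi, test_function Omega phi ->
  (\int[leb]_(x in Omega) (u x * partial i phi x)%:E =
   - \int[leb]_(x in Omega) (g x * phi x)%:E)%E.

(* Weak derivatives are determined up to null sets only, so elements of
   W^{1,p} are handled together with a representative G of their weak
   gradient: [W1p Omega p u G] says that u is in W^{1,p}(Omega) and that
   its weak gradient is G. *)
Definition W1p Omega p u G :=
  Lp Omega p u /\ forall i, Lp Omega p (G i) /\ weak_partial Omega i u (G i).

Definition W1p_norm Omega p u G : \bar R :=
  (('N[leb]_p%:E[EFin \o (u \_ Omega)] `^ p +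
    \sum_i 'N[leb]_p%:E[EFin \o (G i \_ Omega)] `^ p) `^ p^-1)%E.

(* W^{1,p}_0(Omega), the closure of C_c^oo(Omega) in W^{1,p}(Omega) *)
Definition W1p0 Omega p u G := W1p Omega p u G /\
  forall e : R, 0 < e -> exists2 phi, test_function Omega phi &
    (W1p_norm Omega p (u \- phi)%R
       (fun i => G i \- partial i phi)%R < e%:E)%E.

(* The component index comes first: U j is the j-th component of the field and
   [DU j i] its i-th weak partial derivative. *)
Definition W1p0_field Omega p (U : 'I_n.+1 -> V -> R)
    (DU : 'I_n.+1 -> 'I_n.+1 -> V -> R) :=
  forall j, W1p0 Omega p (U j) (DU j).

Definition divergence (DU : 'I_n.+1 -> 'I_n.+1 -> V -> R) : V -> R :=
  fun x => \sum_i DU i i x.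

Definition ae_eq_on Omega f g :=
  {ae leb, forall x, Omega x -> f x = g x}.

Definition cusp (m : R) : set V :=
  [set x | 0 < x ord0 ord0 /\
    Num.sqrt (\sum_(i | i != ord0) x ord0 i ^+ 2) < x ord0 ord0 `^ m].

Definition asymp_first_coord0 Omega f (psi : R -> R) :=
  exists2 c : R, 0 < c & forall e : R, 0 < e -> exists2 eta : R, 0 < eta &
    {ae leb, forall x, (Omega `&` euclid_ball0 eta) x ->
      `|f x / psi (x ord0 ord0) - c| <= e}.

End sobolev.

(* Main.v *)
Require Import Defs.
From HB Require Import structures.
From mathcomp Require Import all_boot all_order all_algebra.
From mathcomp Require Import all_classical all_reals all_analysis.
From mathcomp Require Import measurable_realfun ring lra.
Import Order.TTheory GRing.Theory Num.Theory.
Import numFieldNormedType.Exports.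
Set Implicit Arguments.
Unset Strict Implicit.
Unset Printing Implicit Defensive.
Local Open Scope classical_set_scope.
Local Open Scope ring_scope.

(** Write x_1 for the coordinate [x ord0 ord0], D_t for the part [cusp_below m t]
    of the cusp below the height t, and q for the exponent conjugate to p.

    A field u with divergence f must carry through the section of the cusp at
    height t a flux equal to the integral of f over D_t, which is comparable to
    t ^ (alpha + 1 + m n).  But u vanishes on the lateral boundary and the section
    has width t ^ m, so Poincare's inequality makes the flux small unless the
    gradient of u is large.

    Both facts are used in averaged form, for the weight (t - x_1)_+ ^ 2.
    Integrating by parts along x_1, and then along a transverse coordinate x_j,
    gives on D_t
      int (t - x_1)^2 div u = 2 int (t - x_1) u_1 = - 2 int (t - x_1) x_j d_j u_1.
    For test functions these are [test_transverse] and [test_axial]; both sides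
    involve the gradient only, so [W1p0_limit] carries the identity over to
    W^{1,p}_0.  On the left, f ~ c x_1 ^ alpha gives at least a constant times
    t ^ (3 + alpha + m n) ([divergence_ge]).  On the right, |x_j| < t ^ m and
    Hoelder's inequality give at most a constant times
    t ^ (1 + m + (1 + m n) / q) |d_j u_1|_{L^p(D_t)} ([divergence_le]).

    The upper bound on alpha says exactly that the first exponent is at most the
    second ([scaling_bound]).  Hence |d_j u_1|_{L^p(D_t)} stays above a positive
    constant for all small t, whereas it tends to 0 because D_t shrinks to the
    empty set ([Lnorm_vanishing]). *)

(** * Borel sets of R^n *)

Section borel.
Context {R : realType}.

(** An open set is the union of the countably many cubes with rational centre
    and half-side [1 / (k + 1)] that it contains. *)
Lemma open_measurable_rV n (A : set 'rV[R]_n) : open A -> measurable A.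
Proof.
move=> oA.
pose B (qk : 'rV[rat]_n * nat) : set 'rV[R]_n :=
  \bigcap_(i : 'I_n) (rV_coor i @^-1` ball (ratr (qk.1 ord0 i) : R) qk.2.+1%:R^-1).
have mB qk : measurable (B qk).
  apply: fin_bigcap_measurable => // i _.
  rewrite -[X in measurable X]setTI; apply: measurable_rV_coor => //.
  by apply: open_measurable; apply: ball_open; rewrite invr_gt0.
have -> : A = \bigcup_(qk in [set qk | B qk `<=` A]) B qk.
  apply/seteqP; split => [x Ax|x [qk BA Bx]]; last exact: BA.
  have /nbhs_ballP[e e0 xeA] : nbhs x A by rewrite nbhsE/=; exists A.
  pose k := Num.truncn (2 / e).
  have k2e : (k.+1%:R : R)^-1 < e / 2.
    rewrite -[X in _ < X]invf_div ltf_pV2 ?posrE ?divr_gt0//.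
    exact: truncnS_gt.
  have /choice[q qx] : forall i : 'I_n, exists q : rat,
      `|ratr q - x ord0 i| < k.+1%:R^-1.
    move=> i.
    have /rat_in_itvoo[q] : x ord0 i - k.+1%:R^-1 < x ord0 i + k.+1%:R^-1.
      by rewrite ltrD2l gtrN ?invr_gt0.
    rewrite in_itv/= => /andP[q1 q2]; exists q.
    by rewrite ltr_distl q1 q2.
  exists (\row_i q i, k) => /=; last by move=> i _; rewrite /= mxE; exact: qx.
  move=> y By; apply: xeA; split => // i j; rewrite (ord1 i).
  have := By j I; rewrite /B /= mxE /rV_coor /ball/= => yq.
  have := qx j; move: yq k2e; move: (ratr (q j)) => z.
  set w := x ord0 j; set v := y ord0 j; set u := _^-1.
  rewrite !ltr_norml => /andP[? ?] ? /andP[? ?].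
  by apply/andP; split; lra.
rewrite bigcup_mkcond; apply: countable_bigcupT_measurable => //.
by move=> i; case: ifP.
Qed.

Lemma continuous_measurable_rV n (D : set 'rV[R]_n) (f : 'rV[R]_n -> R) :
  continuous f -> measurable_fun D f.
Proof.
move=> /continuousP cf; apply: measurable_funTS.
apply: (measurability _ (RGenOpens.measurableE R)).
move=> _ [_ [a [b ->] <-]]; rewrite setTI; apply: open_measurable_rV.
exact/cf/interval_open.
Qed.

End borel.

(** * Fubini and the volume of boxes *)

Section fubini_rV.
Context {R : realType}.
Local Notation mu := (@lebesgue_measure R).

Lemma lebesgue_rVS n (A : set 'rV[R]_n.+1) :
  lebesgue_rV n.+1 A = (mu \x lebesgue_rV n)%E (@rV_cons R n @^-1` A).
Proof. by []. Qed.

Section integral.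
Variables (n : nat) (F : 'rV[R]_n.+1 -> \bar R).
Hypothesis intF : (lebesgue_rV n.+1).-integrable setT F.

Let mF : measurable_fun setT F.
Proof. exact: measurable_int intF. Qed.

Let integrable_rV_cons :
  (mu \x lebesgue_rV n)%E.-integrable setT (F \o @rV_cons R n).
Proof.
apply/integrableP; split.
  by apply: measurableT_comp => //; exact: measurable_rV_cons.
have /integrableP[_] := intF; rewrite [X in (X < _)%E -> _](_ : _ =
  (\int[mu \x lebesgue_rV n]_x (abse \o F \o @rV_cons R n) x)%E)//.
rewrite -[RHS](@ge0_integral_pushforward _ _ _ _ _ _ (@measurable_rV_cons R n)
  (mu \x lebesgue_rV n)%E setT)//.
exact: measurableT_comp.
by move=> x _ /=.
Qed.

Let integral_rVE : (\int[lebesgue_rV n.+1]_x F x =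
  \int[mu \x lebesgue_rV n]_x (F \o @rV_cons R n) x)%E.
Proof.
by rewrite -[RHS](@integral_pushforward _ _ _ _ _ _ (@measurable_rV_cons R n)
  (mu \x lebesgue_rV n)%E setT).
Qed.

Lemma integral12_rV : (\int[lebesgue_rV n.+1]_x F x =
  \int[mu]_s \int[lebesgue_rV n]_y F (rV_cons (s, y)))%E.
Proof. by rewrite integral_rVE -integral12_prod_meas1. Qed.

Lemma integral21_rV : (\int[lebesgue_rV n.+1]_x F x =
  \int[lebesgue_rV n]_y \int[mu]_s F (rV_cons (s, y)))%E.
Proof. by rewrite integral_rVE -integral21_prod_meas1. Qed.

End integral.

Definition box n (a b : 'I_n -> R) : set 'rV[R]_n :=
  [set x | forall i, a i <= x ord0 i <= b i].

Lemma measurable_box n (a b : 'I_n -> R) : measurable (box a b).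
Proof.
rewrite (_ : box a b = \bigcap_i (rV_coor i @^-1` `[a i, b i])).
  apply: fin_bigcap_measurable => // i _.
  rewrite -[X in measurable X]setTI; apply: measurable_rV_coor => //.
by apply/seteqP; split=> x xab i; [move=> _|move: (xab i I)]; rewrite /= in_itv/=.
Qed.

Lemma lebesgue_rV_box n (a b : 'I_n -> R) : (forall i, a i <= b i) ->
  lebesgue_rV n (box a b) = (\prod_i (b i - a i))%:E.
Proof.
elim: n a b => [a b _|n IH a b ab].
  rewrite big_ord0 /= diracE mem_set//.
  by case.
rewrite lebesgue_rVS (_ : _ @^-1` _ =
  `[a ord0, b ord0] `*` box (a \o lift ord0) (b \o lift ord0)).
  rewrite product_measure1E//; last exact: measurable_box.
  rewrite IH// => [|i]; last exact: ab.
  rewrite big_ord_recl EFinM; congr (_ * _)%E.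
  rewrite [LHS](lebesgue_measure_itv `[a ord0, b ord0])/= lte_fin.
  by case: ltgtP (ab ord0) => // -> _; rewrite subrr.
apply/seteqP; split => [[s y] /= xab|[s y] [/= + ab'] i].
  split => /=; first by have := xab ord0; rewrite mxE unlift_none in_itv.
  by move=> i; have := xab (lift ord0 i); rewrite mxE liftK.
rewrite in_itv/= mxE; case: unliftP => [j|] -> //= _; exact: ab'.
Qed.

End fubini_rV.

(** * The integral of a partial derivative *)

(** A directional derivative depends only on the restriction to a line, so it can
    be moved between functions on different spaces that agree along lines. *)
Lemma is_derive_line {R : realType} (V V' : normedModType R) (f : V -> R)
    (f' : V' -> R) (a v : V) (a' v' : V') (df : R) :
  (forall h : R, f (h *: v + a) = f' (h *: v' + a')) ->
  is_derive a v f df -> is_derive a' v' f' df.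
Proof.
move=> ff'.
have faf'a : f a = f' a' by have := ff' 0; rewrite !scale0r !add0r.
have Q : (fun h => h^-1 *: ((f \o shift a) (h *: v) - f a)) =
         (fun h => h^-1 *: ((f' \o shift a') (h *: v') - f' a')).
  by apply/funext => h /=; rewrite ff' faf'a.
case; rewrite /derivable /derive Q => df' dfE.
by apply: DeriveDef.
Qed.

Section integral_partial.
Context {R : realType}.
Local Notation mu := (@lebesgue_measure R).

Lemma continuous_rV_cons_r n (s : R) : continuous (fun y => @rV_cons R n (s, y)).
Proof.
move=> y A [P Py PA].
exists (fun i j => P i (lift ord0 j)) => [i j|y' Py'].
  by have := Py i (lift ord0 j); rewrite mxE liftK (ord1 i).
apply: PA => i j; rewrite mxE; case: unliftP => [k|] -> /=.
  by have := Py' i k; rewrite (ord1 i).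
by have := Py i ord0; rewrite mxE unlift_none /=; exact: nbhs_singleton.
Qed.

Lemma continuous_rV_cons_l n (y : 'rV[R]_n) :
  continuous (fun s : R => @rV_cons R n (s, y)).
Proof.
move=> s A [P Py PA].
have P0 : nbhs s (P ord0 ord0) by have := Py ord0 ord0; rewrite mxE unlift_none.
apply: filterS P0 => t Pt; apply: PA => i j; rewrite (ord1 i) mxE.
case: unliftP => [k|] -> //=.
have := Py ord0 (lift ord0 k); rewrite mxE liftK /=; exact: nbhs_singleton.
Qed.

Definition vanish_outside n (M : R) (g : 'rV[R]_n -> R) :=
  forall (x : 'rV[R]_n) (j : 'I_n), M < `|x ord0 j| -> g x = 0.

Lemma continuous_vanish_bounded n M (g : 'rV[R]_n -> R) :
  continuous g -> vanish_outside M g -> exists K, forall x, `|g x| <= K.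
Proof.
move=> cg gM.
pose B : set 'rV[R]_n := [set x | forall i, `[- M, M]%classic (x ord0 i)].
have cB : compact B.
  apply: (@rV_compact _ _ (fun=> `[- M, M]%classic)) => _.
  exact: segment_compact.
have [K [_ KB]] := compact_bounded
  (continuous_compact (continuous_subspaceT cg) cB).
exists (Num.max 0 (K + 1)) => x; rewrite le_max.
have [Bx|/existsNP[j /negP]] := pselect (B x).
  by apply/orP; right; apply: (KB (K + 1)); [rewrite ltrDl|exists x].
rewrite /= in_itv/= -ler_norml -ltNge => /gM ->.
by rewrite normr0 lexx.
Qed.

Lemma continuous_vanish_integrable n M (g : 'rV[R]_n -> R) :
  continuous g -> vanish_outside M g ->
  (lebesgue_rV n).-integrable setT (EFin \o g).
Proof.
move=> cg gM; pose N := Num.max 0 M.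
pose B : set 'rV[R]_n := box (fun=> - N) (fun=> N).
have -> : EFin \o g = (EFin \o g) \_ B.
  apply/funext => x; rewrite /patch; case: ifPn => //.
  rewrite notin_setE => /existsNP[j /negP]; rewrite -ler_norml -ltNge => jx.
  by rewrite /= (gM x j)// (le_lt_trans _ jx)// le_max lexx orbT.
apply/(integrable_mkcond _ (measurable_box _ _)).
have [K gK] := continuous_vanish_bounded cg gM.
apply: measurable_bounded_integrable; first exact: measurable_box.
- have N0 : 0 <= N by rewrite le_max lexx.
  have NN (i : 'I_n) : - N <= N by rewrite (ge0_cp N0).
  by rewrite [ltLHS](lebesgue_rV_box NN) ltry.
- exact: continuous_measurable_rV.
- exists K; split; first exact: num_real.
  by move=> L KL x _; exact: le_trans (gK x) (ltW KL).
Qed.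

Lemma integral_derive0 (M : R) (g g' : R -> R) : continuous g' ->
  (forall x : R, is_derive x (1 : R) g (g' x)) ->
  (forall x, M < `|x| -> g x = 0) -> (forall x, M < `|x| -> g' x = 0) ->
  (\int[mu]_x (g' x)%:E = 0)%E.
Proof.
move=> cg' dg gM g'M; pose N := Num.max 0 M + 1.
have N0 : 0 < N by rewrite ltr_wpDl// le_max lexx.
have MN : M < N by rewrite ltr_pwDr// le_max lexx orbT.
have cg : continuous g.
  move=> x; apply/differentiable_continuous/derivable1_diffP.
  exact: ex_derive.
have -> : (\int[mu]_x (g' x)%:E)%E = (\int[mu]_(x in `[(- N)%R, N]) (g' x)%:E)%E.
  rewrite [RHS]integral_mkcond; apply: eq_integral => x _.
  rewrite /patch; case: ifPn => //.
  rewrite notin_setE/= in_itv/= => /negP; rewrite -ler_norml -ltNge => Nx.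
  by rewrite g'M// (lt_trans MN).
rewrite (@continuous_FTC2 _ g' g).
- by rewrite !gM ?subee// ?normrN gtr0_norm.
- by rewrite gtrN.
- exact: continuous_subspaceT.
- split.
  + by move=> x _; exact: ex_derive.
  + by apply: cvg_at_right_filter; exact: cg.
  + by apply: cvg_at_left_filter; exact: cg.
- by move=> x _; rewrite derive1E derive_val.
Qed.

(** Induction on the dimension: Fubini's theorem isolates the variable [i], where
    the fundamental theorem of calculus applies, as soon as [i] is the first
    coordinate; otherwise the slices fall under the induction hypothesis. *)
Lemma integral_partial0 n (i : 'I_n) (M : R) (g g' : 'rV[R]_n -> R) :
  continuous g' ->
  (forall x, is_derive x (delta_mx ord0 i) g (g' x)) ->
  vanish_outside M g -> vanish_outside M g' ->
  (\int[lebesgue_rV n]_x (g' x)%:E = 0)%E.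
Proof.
elim: n i g g' => [[]//|n IH] i g g' cg' dg gM g'M.
have intg' := continuous_vanish_integrable cg' g'M.
case: (unliftP ord0 i) => [j|] iE.
  rewrite integral12_rV//; apply: integral0_eq => s _.
  apply: (IH j (fun y => g (rV_cons (s, y))) (fun y => g' (rV_cons (s, y)))).
  - move=> y; apply: continuous_comp; first exact: continuous_rV_cons_r.
    exact: cg'.
  - move=> y; apply: is_derive_line (dg (rV_cons (s, y))) => h; congr g.
    apply/rowP => k; rewrite !mxE iE; case: unliftP => [l|] -> /=.
      by rewrite !mxE (inj_eq lift_inj).
    by rewrite mulr0 add0r.
  - by move=> y k Mk; apply: (gM _ (lift ord0 k)); rewrite mxE liftK.
  - by move=> y k Mk; apply: (g'M _ (lift ord0 k)); rewrite mxE liftK.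
rewrite integral21_rV//; apply: integral0_eq => y _.
apply: (@integral_derive0 M (fun s => g (rV_cons (s, y)))).
- move=> s; apply: continuous_comp; first exact: continuous_rV_cons_l.
  exact: cg'.
- move=> s; apply: is_derive_line (dg (rV_cons (s, y))) => h; congr g.
  apply/rowP => k; rewrite !mxE iE; case: unliftP => [l|] -> /=.
    by rewrite mulr0 add0r.
  by [].
- by move=> s Ms; apply: (gM _ ord0); rewrite mxE unlift_none.
- by move=> s Ms; apply: (g'M _ ord0); rewrite mxE unlift_none.
Qed.

End integral_partial.

(** * Coordinates and the cut-off in x_1 *)

Section coordinates.
Context {R : realType} {n : nat}.
Local Notation V := 'rV[R]_n.+1.

Lemma continuous_coor (i : 'I_n.+1) : continuous (fun x : V => x ord0 i).
Proof. exact: coord_continuous. Qed.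

Lemma continuous_euclid_norm : continuous (@euclid_norm R n).
Proof.
move=> x; apply: (@continuous_comp _ _ _ (fun x : V => \sum_i x ord0 i ^+ 2));
  last exact: sqrt_continuous.
suff : forall r : seq 'I_n.+1,
    continuous (fun x : V => \sum_(i <- r) x ord0 i ^+ 2).
  exact.
elim=> [|i r IH] {}x.
  rewrite (_ : (fun _ => _) = cst 0); first exact: cst_continuous.
  by apply/funext => y; rewrite big_nil.
rewrite (_ : (fun _ => _) =
    (fun y : V => y ord0 i ^+ 2 + \sum_(j <- r) y ord0 j ^+ 2)).
  apply: (@continuousD _ _ _ (fun y : V => y ord0 i ^+ 2)); last exact: IH.
  apply: (@continuous_comp _ _ _ (fun y : V => y ord0 i) (fun r : R => r ^+ 2)).
    exact: continuous_coor.
  exact: exprn_continuous.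
by apply/funext => y; rewrite big_cons.
Qed.

Lemma ge_euclid_norm (x : V) i : `|x ord0 i| <= euclid_norm x.
Proof.
rewrite -sqrtr_sqr ler_sqrt ?sumr_ge0// => [|j _]; last exact: sqr_ge0.
by rewrite (bigD1 i)//= lerDl sumr_ge0// => j _; exact: sqr_ge0.
Qed.

(** The positive part makes [ramp t x ^+ 2] a C^1 function of x_1 that vanishes
    above the height [t], so that cutting the cusp there leaves no boundary term. *)
Definition ramp (t : R) (x : V) : R := Num.max (t - x ord0 ord0) 0.

Lemma ramp_ge0 t (x : V) : 0 <= ramp t x.
Proof. by rewrite /ramp le_max lexx orbT. Qed.

Lemma ramp0 t (x : V) : t <= x ord0 ord0 -> ramp t x = 0.
Proof. by move=> ?; apply/max_idPr; rewrite subr_le0. Qed.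

Lemma rampE t (x : V) : x ord0 ord0 < t -> ramp t x = t - x ord0 ord0.
Proof. by move=> ?; apply/max_idPl; rewrite subr_ge0 ltW. Qed.

Lemma continuous_ramp t : continuous (ramp t).
Proof.
move=> x; apply: (@continuous_max _ _ (fun x : V => t - x ord0 ord0) (cst 0)).
  apply: (@continuousB _ _ _ (cst t)); first exact: cst_continuous.
  exact: continuous_coor.
exact: cst_continuous.
Qed.

Lemma continuous_sqr_ramp t : continuous (fun x : V => ramp t x ^+ 2).
Proof.
move=> x; apply: (@continuous_comp _ _ _ (ramp t) (fun r : R => r ^+ 2)).
  exact: continuous_ramp.
exact: exprn_continuous.
Qed.

Lemma continuous_double_ramp t : continuous (fun x : V => 2 * ramp t x).
Proof.
move=> x; apply: (@continuousM _ _ (cst 2)); first exact: cst_continuous.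
exact: continuous_ramp.
Qed.

Lemma continuous_ramp_coor t j :
  continuous (fun x : V => 2 * ramp t x * x ord0 j).
Proof.
move=> x; apply: (@continuousM _ _ (fun x => 2 * ramp t x)).
  exact: continuous_double_ramp.
exact: continuous_coor.
Qed.

Lemma is_derive_coor (x : V) (i j : 'I_n.+1) :
  is_derive x (delta_mx ord0 i) (fun x => x ord0 j) (i == j)%:R.
Proof.
have d : is_derive (0 : R) (1 : R)
    (cst (x ord0 j) + (i == j)%:R \*: id) ((i == j)%:R).
  by apply: is_derive_eq; rewrite add0r [LHS]mulr1.
apply: is_derive_line d => h.
rewrite !mxE /= addr0 (eq_sym j).
change (x ord0 j + (i == j)%:R * (h * 1) = h * (i == j)%:R + x ord0 j).
by rewrite mulr1 addrC mulrC.
Qed.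

Lemma is_derive_ramp (t : R) (x : V) (i : 'I_n.+1) : i != ord0 ->
  is_derive x (delta_mx ord0 i) (ramp t) 0.
Proof.
move=> i0; apply: (@is_derive_line _ _ _ (cst (ramp t x)) _ (0 : R) 1 x).
by move=> h; rewrite /ramp !mxE /= eq_sym (negbTE i0) mulr0 add0r.
Qed.

End coordinates.

(** At 0 the difference quotient is [Num.max h 0], which tends to 0. *)
Lemma is_derive_sqr_max0 {R : realType} (y : R) :
  is_derive y 1 (fun y : R => Num.max y 0 ^+ 2) (2 * Num.max y 0).
Proof.
have [y0|y0|->] := ltgtP y 0.
- rewrite mulr0; apply: (@near_eq_is_derive _ _ _ (cst 0)) => //.
  near=> z; rewrite /cst (max_idPr _) ?expr0n//.
  by apply: ltW; near: z; exact: lt_nbhsl.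
- apply: (@near_eq_is_derive _ _ _ (fun z : R => z ^+ 2)).
    near=> z; rewrite (max_idPl _)//.
    by apply: ltW; near: z; exact: lt_nbhsr.
  by apply: is_derive_eq; rewrite [y%:A]mulr1 mulr_natl.
- rewrite mulr0.
  have c : (fun h : R => h^-1 *: (((fun y : R => Num.max y 0 ^+ 2) \o shift 0)
     (h *: (1 : R)) - Num.max 0 0 ^+ 2)) @ 0^' --> (0 : R).
    have : (fun h : R => Num.max h 0) @ 0^' --> (0 : R).
      rewrite -[X in _ --> X](maxxx (0 : R)).
      apply: cvg_within_filter.
      apply: (@continuous_max _ _ id (cst 0)); [exact: cvg_id|exact: cvg_cst].
    apply: cvg_trans; apply: near_eq_cvg; near=> h.
    have h0 : h != 0 by near: h; exact: nbhs_dnbhs_neq.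
    rewrite /= addr0 maxxx expr0n subr0 [h *: 1]mulr1.
    have [?|?] := leP h 0; first by rewrite expr0n /= scaler0.
    by rewrite -[LHS](mulKf h0).
  apply: DeriveDef; first by apply/cvg_ex; exists 0.
  exact: cvg_lim c.
Unshelve. all: by end_near. Qed.

(** * Truncation to the end of the cusp *)

Section test_functions.
Context {R : realType} {n : nat}.
Local Notation V := 'rV[R]_n.+1.
Variables (Omega : set V) (phi : V -> R).
Hypothesis tphi : test_function Omega phi.

Lemma test_continuous : continuous phi.
Proof. by have [/(_ 0)] := tphi. Qed.

Lemma test_is_derive i (x : V) :
  is_derive x (delta_mx ord0 i) phi (partial i phi x).
Proof. by have [/(_ 1)[_ /(_ i)[d _]] _ _] := tphi; exact: DeriveDef. Qed.

Lemma test_partial_continuous i : continuous (partial i phi).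
Proof. by have [/(_ 1)[_ /(_ i)[]]] := tphi. Qed.

Lemma test_out (x : V) : ~ Omega x -> phi x = 0.
Proof.
move=> Ox; have [_ _ supp] := tphi; apply/eqP/negPn/negP => phi0.
by apply/Ox/supp/subset_closure.
Qed.

Lemma test_partial_out i (x : V) : ~ Omega x -> partial i phi x = 0.
Proof.
move=> Ox; have [_ _ supp] := tphi.
have : \forall y \near x, cst 0 y = phi y.
  have : nbhs x (~` closure [set x | phi x != 0]).
    by apply: open_nbhs_nbhs; split; [exact/closed_openC/closed_closure|move/supp].
  apply: filterS => y; rewrite /= => ny; apply/esym/eqP/negPn/negP => phi0.
  by apply: ny; exact: subset_closure.
by rewrite /partial => /near_eq_derive <-; exact: derive_cst.
Qed.

End test_functions.

Section cusp_end.
Context {R : realType} {n : nat}.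
Local Notation V := 'rV[R]_n.+1.
Local Notation leb := (@lebesgue_rV R n.+1).
Variables (m : R).

Definition cusp_below (t : R) : set V := cusp m `&` [set x | x ord0 ord0 < t].

Lemma cusp_below_coor t (x : V) i : cusp_below t x -> i != ord0 ->
  `|x ord0 i| < x ord0 ord0 `^ m.
Proof.
move=> [[x0 xm] xt] i0; apply: le_lt_trans xm.
rewrite -sqrtr_sqr ler_sqrt ?sumr_ge0// => [|j _]; last exact: sqr_ge0.
by rewrite (bigD1 i)//= lerDl sumr_ge0// => j _; exact: sqr_ge0.
Qed.

(** Since [m >= 1], the cusp lies in the cone of slope 1 below the height 1; the
    low part of the cusp is thus near the origin, away from the rest of the
    domain. *)
Lemma cusp_below_norm t (x : V) : 1 <= m -> t <= 1 -> cusp_below t x ->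
  euclid_norm x < 2 * t.
Proof.
move=> m1 t1 [[x0 xm] xt]; set r := x ord0 ord0 in x0 xm xt.
have {}xm : Num.sqrt (\sum_(i | i != ord0) x ord0 i ^+ 2) < t.
  rewrite (lt_le_trans xm)// (le_trans _ (ltW xt))// ge1r_powR//.
  by rewrite x0 ltW// (lt_le_trans xt).
have t0 : 0 < t by exact: lt_trans xt.
rewrite -[ltRHS]gtr0_norm ?mulr_gt0// -sqrtr_sqr ltr_sqrt; last first.
  by rewrite exprn_gt0 ?mulr_gt0.
rewrite (bigD1 ord0)//= -/r.
have : Num.sqrt (\sum_(i | i != ord0) x ord0 i ^+ 2) ^+ 2 < t ^+ 2.
  by rewrite ltr_pXn2r// ?nnegrE ?sqrtr_ge0// ltW.
rewrite sqr_sqrtr ?sumr_ge0// => [|j _]; last exact: sqr_ge0.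
have : r ^+ 2 < t ^+ 2 by rewrite ltr_pXn2r// ?nnegrE ?ltW.
move: (\sum_(_ | _) _) => S; nra.
Qed.

Variables (delta t : R) (Omega : set V).
Hypotheses (m_ge1 : 1 <= m) (Omega_open : open Omega)
  (t_le1 : t <= 1) (t_delta : 2 * t < delta).
Hypothesis Omega_cusp :
  Omega `&` euclid_ball0 delta = cusp m `&` euclid_ball0 delta.
Local Notation D := (cusp_below t).

Lemma cusp_belowE :
  D = Omega `&` euclid_ball0 delta `&` [set x | x ord0 ord0 < t].
Proof.
rewrite Omega_cusp; apply/seteqP; split=> [x Dx|x [[]]//].
split; last by case: Dx.
split; first by case: Dx.
by apply: lt_trans t_delta; exact: cusp_below_norm.
Qed.

Lemma cusp_below_sub : D `<=` Omega.
Proof. by rewrite cusp_belowE => x [[]]. Qed.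

Lemma cusp_below_open : open D.
Proof.
rewrite cusp_belowE; apply: openI; first apply: openI => //.
  have /continuousP/(_ _ (@open_lt _ delta)) := @continuous_euclid_norm R n.
  exact.
have /continuousP/(_ _ (@open_lt _ t)) := @continuous_coor R n ord0.
exact.
Qed.

Lemma cusp_below_measurable : measurable D.
Proof. by apply: open_measurable_rV; exact: cusp_below_open. Qed.

(** A function supported in [Omega] and below the height [t] stays C^1 when it is
    set to 0 outside the end of the cusp: it is unchanged near the points of the
    ball, and 0 near the others. *)
Lemma cusp_below_near (x : V) :
  (\forall y \near x, Omega y -> y ord0 ord0 < t -> D y) \/
  (\forall y \near x, ~ D y).
Proof.
have [xd|xd] := ltP (euclid_norm x) delta; [left|right].
  have /continuousP/(_ _ (@open_lt _ delta)) := @continuous_euclid_norm R n.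
  move=> o; have := open_nbhs_nbhs (conj o xd).
  by apply: filterS => y /= yd Oy yt; rewrite cusp_belowE.
have /continuousP/(_ _ (@open_gt _ (2 * t))) := @continuous_euclid_norm R n.
move=> o; have := open_nbhs_nbhs (conj o (lt_le_trans t_delta xd)).
apply: filterS => y /= yd /(cusp_below_norm m_ge1 t_le1).
by move/(lt_trans yd); rewrite ltxx.
Qed.

Section truncation.
Variables (g g' : V -> R) (i : 'I_n.+1).
Hypotheses (cg' : continuous g')
  (dg : forall x, is_derive x (delta_mx ord0 i) g (g' x))
  (g0 : forall x, ~ Omega x \/ t <= x ord0 ord0 -> g x = 0)
  (g'0 : forall x, ~ Omega x \/ t <= x ord0 ord0 -> g' x = 0).

Let trunc_near (h : V -> R) (x : V) :
    (forall x, ~ Omega x \/ t <= x ord0 ord0 -> h x = 0) ->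
  (\forall y \near x, Omega y -> y ord0 ord0 < t -> D y) ->
  \forall y \near x, h y = (h \_ D) y.
Proof.
move=> h0; apply: filterS => y Dy; rewrite patchE; case: ifPn => //.
rewrite notin_setE => nDy; apply: h0.
by have [yt|] := ltP (y ord0 ord0) t; [left=> Oy; exact/nDy/Dy|right].
Qed.

Let trunc_near0 (h : V -> R) (x : V) :
  (\forall y \near x, ~ D y) -> \forall y \near x, cst 0 y = (h \_ D) y.
Proof. by apply: filterS => y Dy; rewrite patchE memNset. Qed.

Let trunc_derive x : is_derive x (delta_mx ord0 i) (g \_ D) ((g' \_ D) x).
Proof.
have [xD|xD] := cusp_below_near x.
  rewrite -(nbhs_singleton (trunc_near g'0 xD)).
  exact: near_eq_is_derive (trunc_near g0 xD) (dg x).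
rewrite -(nbhs_singleton (trunc_near0 g' xD)).
exact: near_eq_is_derive (trunc_near0 g xD) (is_derive_cst _ _ _).
Qed.

Let trunc_continuous : continuous (g' \_ D).
Proof.
move=> x; rewrite /continuous_at; have [xD|xD] := cusp_below_near x.
  rewrite -(nbhs_singleton (trunc_near g'0 xD)).
  have H : (g' \_ D) @ nbhs x `=>` g' @ nbhs x.
    by apply: near_eq_cvg; apply: trunc_near.
  by move=> A Ag'; apply: H; exact: cg' Ag'.
rewrite -(nbhs_singleton (trunc_near0 g' xD)).
have H : (g' \_ D) @ nbhs x `=>` cst 0 @ nbhs x.
  by apply: near_eq_cvg; apply: trunc_near0.
move=> A /nbhs_singleton A0; apply: H.
by apply: (@filterE _ (nbhs x) _ (fun y => A (cst 0 y))) => y; exact: A0.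
Qed.

Let trunc_vanish (h : V -> R) : vanish_outside (2 * t) (h \_ D).
Proof.
move=> x j xt; rewrite patchE; case: ifPn => // /set_mem Dx; exfalso.
have := cusp_below_norm m_ge1 t_le1 Dx; rewrite ltNge => /negP; apply.
exact: le_trans (ltW xt) (ge_euclid_norm _ _).
Qed.

Lemma integrable_cusp_below : leb.-integrable D (EFin \o g').
Proof.
apply/(integrable_mkcond _ cusp_below_measurable).
rewrite restrict_EFin.
exact: continuous_vanish_integrable trunc_continuous (trunc_vanish g').
Qed.

Lemma integral_cusp_below0 : (\int[leb]_(x in D) (g' x)%:E = 0)%E.
Proof.
rewrite integral_mkcond; under eq_integral do rewrite restrict_EFin.
exact: integral_partial0 trunc_continuous trunc_derive
  (trunc_vanish g) (trunc_vanish g').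
Qed.

End truncation.
End cusp_end.

(** * Bounds in L^p and passage to the limit in the gradient *)

Section hoelder_on.
Context d (T : measurableType d) (R : realType) (mu : {measure set T -> \bar R}).

(** Hoelder's inequality against the indicator of [D]. *)
Lemma integral_le_Lnorm (D : set T) (p q : R) (g : T -> R) :
  measurable D -> measurable_fun setT g -> 0 < p -> 0 < q -> p^-1 + q^-1 = 1 ->
  (\int[mu]_(x in D) `|(g x)%:E| <=
   'N[mu]_p%:E[EFin \o g] * mu D `^ q^-1)%E.
Proof.
move=> mD mg p0 q0 pq.
have := hoelder mu mg (measurable_indic (D := setT) mD) p0 q0 pq.
have -> : ('N[mu]_q%:E[EFin \o \1_D] = mu D `^ q^-1)%E.
  rewrite unlock /Lnorm; congr (_ `^ _)%E.
  rewrite -(setIT D) -integral_indic//; apply: eq_integral => x _ /=.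
  rewrite setIT indicE; case: (_ \in _); rewrite ?normr1 ?normr0 ?powR1//.
  by rewrite powR0// gt_eqF.
apply: le_trans; rewrite Lnorm1 integral_mkcond le_eqVlt; apply/orP; left.
apply/eqP; apply: eq_integral => x _; rewrite /= patchE indicE.
by case: (_ \in _); rewrite ?mulr1 ?mulr0 ?normr0.
Qed.

Lemma integrable_Lnorm (D : set T) (p q : R) (g : T -> R) :
  measurable D -> measurable_fun setT g -> 0 < p -> 0 < q -> p^-1 + q^-1 = 1 ->
  (mu D < +oo)%E -> ('N[mu]_p%:E[EFin \o g] < +oo)%E ->
  mu.-integrable D (EFin \o g).
Proof.
move=> mD mg p0 q0 pq Doo goo; apply/integrableP; split.
  by apply/measurable_EFinP; exact: measurable_funTS.
apply: le_lt_trans (integral_le_Lnorm mD mg p0 q0 pq) _.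
apply: lte_mul_pinfty => //; last exact: poweR_lty.
  exact: Lnorm_ge0.
by rewrite ge0_fin_numE// Lnorm_ge0.
Qed.

Lemma integrable_weight (D : set T) (K : R) (c h : T -> R) :
  measurable D -> measurable_fun D c -> (forall x, D x -> `|c x| <= K) ->
  mu.-integrable D (EFin \o h) -> mu.-integrable D (EFin \o (fun x => c x * h x)).
Proof.
move=> mD mc cK ih.
change (mu.-integrable D ((EFin \o c) \* (EFin \o h))%E).
apply: integrableMr => //; exists K; split; first exact: num_real.
by move=> L KL x /cK/le_trans; apply; exact: ltW.
Qed.

(** Dominated convergence for the p-th powers: they tend to 0 pointwise, because
    each point leaves the sets [D k]. *)
Lemma Lnorm_vanishing (p : R) (g : T -> R) (D : (set T)^nat) (e : R) :
  0 < p -> measurable_fun setT g -> ('N[mu]_p%:E[EFin \o g] < +oo)%E ->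
  (forall k, measurable (D k)) ->
  (forall x, \forall k \near \oo, ~ D k x) -> 0 < e ->
  \forall k \near \oo, ('N[mu]_p%:E[EFin \o (g \_ (D k))] < e%:E)%E.
Proof.
move=> p0 mg goo mD Dx e0.
pose h k x := (`|(g \_ (D k)) x| `^ p)%:E.
have mabs (f : T -> R) : measurable_fun setT f ->
    measurable_fun setT (fun x => (`|f x| `^ p)%:E).
  move=> mf; apply/measurable_EFinP.
  apply: (@measurableT_comp _ _ _ _ _ _ (@powR R ^~ p)) => //.
  exact: measurableT_comp.
have mh k : measurable_fun setT (h k).
  apply: mabs; apply/(measurable_restrictT _ (mD k)).
  exact: measurable_funTS.
have ig : mu.-integrable setT (fun x => (`|g x| `^ p)%:E).
  apply/integrableP; split; first exact: mabs.
  have -> : (\int[mu]_x `|(`|g x| `^ p)%:E| = 'N[mu]_p%:E[EFin \o g] `^ p)%E.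
    rewrite poweR_Lnorm ?gt_eqF//; apply: eq_integral => x _.
    by rewrite gee0_abs ?lee_fin ?powR_ge0.
  exact: poweR_lty.
have cv : {ae mu, forall x, setT x -> h ^~ x @ \oo --> cst 0%E x}.
  apply: aeW => x _; apply: cvg_near_cst; apply: filterS (Dx x) => k nDx.
  by rewrite /h patchE memNset// normr0 powR0// gt_eqF.
have bd : {ae mu, forall x k, setT x -> (`|h k x| <= (`|g x| `^ p)%:E)%E}.
  apply: aeW => x k _; rewrite /h gee0_abs ?lee_fin ?powR_ge0// patchE.
  by case: (_ \in _); rewrite ?normr0 ?powR0 ?powR_ge0// gt_eqF.
have [_ _] := dominated_convergence measurableT mh (measurable_cst _) cv ig bd.
rewrite integral_cst// mul0e => /fine_cvgP[hfin /cvgr_lt hlt].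
have ep : 0 < e `^ p by rewrite powR_gt0.
apply: filterS2 hfin (hlt _ ep) => k /= hkfin hk.
rewrite unlock -[X in (X `^ _)%E](fineK hkfin) poweR_EFin lte_fin.
have -> : e = (e `^ p) `^ p^-1 by rewrite -powRrM mulfV ?gt_eqF// powRr1// ltW.
apply: gt0_ltr_powR => //; rewrite ?invr_gt0// ?nnegrE ?(ltW ep)//.
by apply: fine_ge0; apply: integral_ge0 => x _; rewrite lee_fin powR_ge0.
Qed.

End hoelder_on.

Section sobolev_limit.
Context {R : realType} {n : nat}.
Local Notation V := 'rV[R]_n.+1.
Local Notation leb := (@lebesgue_rV R n.+1).
Variables (Omega D : set V) (p q : R) (u : V -> R) (G : 'I_n.+1 -> V -> R).
Hypotheses (mD : measurable D) (DOmega : D `<=` Omega) (Doo : (leb D < +oo)%E)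
  (p_gt0 : 0 < p) (q_gt0 : 0 < q) (pq : p^-1 + q^-1 = 1)
  (mOmega : measurable Omega) (uG : W1p0 Omega p u G).

Lemma W1p_norm_ge (v : V -> R) (H : 'I_n.+1 -> V -> R) i :
  ('N[leb]_p%:E[EFin \o (H i \_ Omega)] <= W1p_norm Omega p v H)%E.
Proof.
have E : ('N[leb]_p%:E[EFin \o (H i \_ Omega)] =
    ('N[leb]_p%:E[EFin \o (H i \_ Omega)] `^ p) `^ p^-1)%E.
  by rewrite -poweRrM mulfV ?gt_eqF// poweRe1// Lnorm_ge0.
rewrite /W1p_norm [leLHS]E; apply: gt0_ler_poweR; rewrite ?invr_ge0 ?(ltW p_gt0)//.
- by rewrite in_itv/= poweR_ge0 leey.
- rewrite in_itv/= leey andbT adde_ge0 ?poweR_ge0// sume_ge0// => j _.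
  exact: poweR_ge0.
rewrite (bigD1 i)//= addeCA leeDl// adde_ge0 ?poweR_ge0// sume_ge0// => j _.
exact: poweR_ge0.
Qed.

Let mG i : measurable_fun setT (G i \_ Omega).
Proof.
have [[_ /(_ i)[/sub_Lfun_mfun/set_mem]]] := uG.
exact.
Qed.

Lemma W1p0_integrable i : leb.-integrable D (EFin \o G i).
Proof.
have [[_ /(_ i)[/sub_Lfun_finLfun/set_mem Goo _]] _] := uG.
apply: eq_integrable (integrable_Lnorm mD (mG i) p_gt0 q_gt0 pq Doo Goo) => //.
by move=> x /set_mem/DOmega Ox; rewrite /= patchE mem_set.
Qed.

Lemma test_restrict_measurable phi i : test_function Omega phi ->
  measurable_fun setT (partial i phi \_ Omega).
Proof.
move=> tphi; apply/(measurable_restrictT _ mOmega).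
apply: continuous_measurable_rV; exact: test_partial_continuous tphi _.
Qed.

(** The integral is linear in the gradient with bounded weights, hence continuous
    for the L^1 norm on [D]; the measure of [D] being finite, this norm is
    controlled by the L^p norm, in which gradients of test functions approximate
    [G]. *)
Lemma W1p0_limit (K : R) (a b : V -> R) (i j : 'I_n.+1) :
  continuous a -> continuous b ->
  (forall x, D x -> `|a x| <= K) -> (forall x, D x -> `|b x| <= K) ->
  (forall phi, test_function Omega phi ->
    (\int[leb]_(x in D) (a x * partial i phi x + b x * partial j phi x)%:E = 0)%E) ->
  (\int[leb]_(x in D) (a x * G i x + b x * G j x)%:E = 0)%E.
Proof.
move=> ca cb aK bK H0.
(* The set D may be empty, so K itself need not be positive. *)
have K0 : exists2 L, 0 < L & forall x, D x -> `|a x| <= L /\ `|b x| <= L.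
  exists (`|K| + 1); first by rewrite ltr_wpDl.
  move=> x Dx; split.
    by rewrite (le_trans (aK _ Dx))// (le_trans (ler_norm _))// lerDl.
  by rewrite (le_trans (bK _ Dx))// (le_trans (ler_norm _))// lerDl.
have {K aK bK K0}[K K0 abK] := K0.
have intM (c h : V -> R) : continuous c -> (forall x, D x -> `|c x| <= K) ->
    leb.-integrable D (EFin \o h) -> leb.-integrable D (fun x => (c x * h x)%:E).
  move=> cc cK; apply: (integrable_weight mD _ cK).
  exact: continuous_measurable_rV.
have aK x : D x -> `|a x| <= K by case/abK.
have bK x : D x -> `|b x| <= K by case/abK.
set I := (X in X = 0); apply/eqP; rewrite -abse_eq0 eq_le abse_ge0 andbT.
have M0 : (0 <= leb D `^ q^-1 < +oo)%E by rewrite poweR_ge0 poweR_lty.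
set M := fine (leb D `^ q^-1)%E.
have ME : (leb D `^ q^-1)%E = M%:E by rewrite fineK// ge0_fin_numE; case/andP: M0.
apply/lee_addgt0Pr => e e0; rewrite add0e.
pose eta := e / (2 * K * (M + 1)).
have M_ge0 : 0 <= M by rewrite fine_ge0//; case/andP: M0.
have eta0 : 0 < eta by rewrite divr_gt0// !mulr_gt0// ltr_wpDl.
have [phi tphi phie] := uG.2 _ eta0.
pose w k x := G k x - partial k phi x.
have wE k : w k \_ Omega = (G k \_ Omega) \- (partial k phi \_ Omega).
  apply/funext => x; rewrite /w !patchE /=.
  by case: ifP; rewrite ?patchE ?subr0 => ->; rewrite ?subr0.
have mw k : measurable_fun setT (w k \_ Omega).
  by rewrite wE; apply: measurable_funB => //; exact: test_restrict_measurable.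
have wn k : ('N[leb]_p%:E[EFin \o (w k \_ Omega)] < eta%:E)%E.
  exact: le_lt_trans (W1p_norm_ge _ _ k) phie.
have wD k : {in D, EFin \o (w k \_ Omega) =1 EFin \o w k}.
  by move=> x /set_mem/DOmega Ox; rewrite /= patchE mem_set.
have iw k : leb.-integrable D (EFin \o w k).
  apply: eq_integrable (integrable_Lnorm mD (mw k) p_gt0 q_gt0 pq Doo _) => //.
  exact: lt_trans (wn k) (ltry _).
have ip k : leb.-integrable D (EFin \o partial k phi).
  have := integrableB mD (W1p0_integrable k) (iw k).
  by apply: eq_integrable => // x _; rewrite /= -EFinB /w opprB addrC subrK.
have nw k : (\int[leb]_(x in D) `|(w k x)%:E| <= (eta * M)%:E)%E.
  have := integral_le_Lnorm leb mD (mw k) p_gt0 q_gt0 pq.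
  rewrite ME (@eq_integral _ _ _ _ D (fun x => `|(w k x)%:E|)%E).
    move=> /le_trans; apply; rewrite EFinM; apply: lee_wpmul2r.
      by rewrite lee_fin.
    exact: ltW.
  by move=> x xD; congr (`| _ |)%E; rewrite -[RHS](wD k x xD).
have iaw : leb.-integrable D (fun x => (a x * w i x)%:E) by exact: intM.
have ibw : leb.-integrable D (fun x => (b x * w j x)%:E) by exact: intM.
have -> : I = (\int[leb]_(x in D) ((a x * w i x)%:E + (b x * w j x)%:E))%E.
  have iD (h : 'I_n.+1 -> V -> R) : (forall k, leb.-integrable D (EFin \o h k)) ->
      leb.-integrable D (EFin \o (fun x => a x * h i x + b x * h j x)).
    move=> ih; have := integrableD mD (intM _ _ ca aK (ih i)) (intM _ _ cb bK (ih j)).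
    exact.
  have iG := iD _ W1p0_integrable.
  have iphi := iD (fun k => partial k phi) ip.
  rewrite -[LHS]sube0 -(H0 _ tphi) /I -(integralB_EFin mD iG iphi).
  apply: eq_integral => x _; rewrite -EFinB -EFinD /w; congr EFin; ring.
apply: le_trans (le_abse_integral leb mD _) _.
  by apply: emeasurable_funD; [exact: measurable_int iaw|exact: measurable_int ibw].
apply: (@le_trans _ _ (\int[leb]_(x in D)
    (K%:E * `|(w i x)%:E| + K%:E * `|(w j x)%:E|))%E).
  apply: ge0_le_integral => //.
  - by apply: measurableT_comp => //; apply: emeasurable_funD;
      [exact: measurable_int iaw|exact: measurable_int ibw].
  - apply: emeasurable_funD; apply: emeasurable_funM => //;
      by apply: measurableT_comp => //; exact: measurable_int (iw _).
  - move=> x Dx; rewrite -EFinD /= lee_fin (le_trans (ler_normD _ _))//.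
    by rewrite !normrM lerD// ler_wpM2r// ?aK ?bK.
rewrite ge0_integralD//; first last.
- apply: emeasurable_funM => //.
  by apply: measurableT_comp => //; exact: measurable_int (iw _).
- by move=> x _; rewrite mule_ge0// lee_fin ltW.
- apply: emeasurable_funM => //.
  by apply: measurableT_comp => //; exact: measurable_int (iw _).
- by move=> x _; rewrite mule_ge0// lee_fin ltW.
rewrite !ge0_integralZl//; first last.
- by rewrite lee_fin ltW.
- by apply: measurableT_comp => //; exact: measurable_int (iw _).
- by rewrite lee_fin ltW.
- by apply: measurableT_comp => //; exact: measurable_int (iw _).
apply: (@le_trans _ _ (K%:E * (eta * M)%:E + K%:E * (eta * M)%:E)%E).
  by apply: leeD; apply: lee_wpmul2l; rewrite ?lee_fin ?(ltW K0)//; exact: nw.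
rewrite -!EFinM -EFinD lee_fin.
have -> : K * (eta * M) + K * (eta * M) = e * (M / (M + 1)).
  by rewrite /eta; field; rewrite !gt_eqF// ltr_wpDl.
rewrite ler_piMr ?(ltW e0)// ler_pdivrMr ?ltr_wpDl// mul1r.
by rewrite lerDl.
Qed.

End sobolev_limit.

(** * Two identities for test functions *)

Lemma is_derive_sqr_ramp {R : realType} {n : nat} (t : R) (x : 'rV[R]_n.+1) :
  is_derive x (delta_mx ord0 ord0) (fun x => ramp t x ^+ 2) (- (2 * ramp t x)).
Proof.
pose s := x ord0 ord0.
have d1 : is_derive s (1 : R) (fun s => t - s) (- 1).
  by apply: is_derive_eq; rewrite add0r mul1r.
have := @is_derive1_comp _ (fun y => Num.max y 0 ^+ 2) (fun s => t - s) s _ _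
  (is_derive_sqr_max0 (t - s)) d1.
rewrite mulrN1; apply: is_derive_line => h.
by rewrite /ramp !mxE /=; congr (Num.max (_ - (_ + _)) _ ^+ 2).
Qed.

Section identities.
Context {R : realType} {n : nat}.
Local Notation V := 'rV[R]_n.+1.
Local Notation leb := (@lebesgue_rV R n.+1).
Variables (m delta t : R) (Omega : set V).
Hypotheses (m_ge1 : 1 <= m) (Omega_open : open Omega)
  (t_le1 : t <= 1) (t_delta : 2 * t < delta).
Hypothesis Omega_cusp :
  Omega `&` euclid_ball0 delta = cusp m `&` euclid_ball0 delta.
Local Notation D := (@cusp_below R n m t).

Let mD : measurable D.
Proof. exact: (cusp_below_measurable m_ge1 Omega_open t_le1 t_delta Omega_cusp). Qed.

Section test.
Variable phi : V -> R.
Hypothesis tphi : test_function Omega phi.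

Let dphi i x := test_is_derive tphi i x.

(** The weight does not depend on x_i, so the integrand is the derivative of
    [ramp t ^ 2 * phi] along x_i. *)
Lemma test_transverse i : i != ord0 ->
  (\int[leb]_(x in D) (ramp t x ^+ 2 * partial i phi x)%:E = 0)%E.
Proof.
move=> i0.
apply: (integral_cusp_below0 (g := fun x => ramp t x ^+ 2 * phi x) (i := i)
  m_ge1 t_le1 t_delta Omega_cusp).
- move=> x; apply: (@continuousM _ _ (fun x => ramp t x ^+ 2)).
    exact: continuous_sqr_ramp.
  exact: test_partial_continuous tphi i x.
- move=> x; have d1 := is_derive_ramp t x i0; have d2 := dphi i x.
  by apply: is_derive_eq; rewrite !scaler0 addr0 scaler0 addr0.
- move=> x [/(test_out tphi) ->|/ramp0 ->]; first by rewrite mulr0.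
  by rewrite expr0n mul0r.
- move=> x [/(test_partial_out tphi) ->|/ramp0 ->]; first by rewrite mulr0.
  by rewrite expr0n mul0r.
Qed.

(** Differentiating [ramp t ^ 2 * phi] along x_1 leaves the term
    [- 2 * ramp t * phi]; it is cancelled by the derivative of
    [2 * ramp t * x_j * phi] along x_j, so that only the gradient of [phi]
    remains. *)
Lemma test_axial j : j != ord0 -> (\int[leb]_(x in D)
  (ramp t x ^+ 2 * partial ord0 phi x +
   2 * ramp t x * x ord0 j * partial j phi x)%:E = 0)%E.
Proof.
move=> j0.
pose g1 x := ramp t x ^+ 2 * phi x.
pose g1' x := ramp t x ^+ 2 * partial ord0 phi x - 2 * ramp t x * phi x.
pose g2 (x : V) := 2 * ramp t x * x ord0 j * phi x.
pose g2' (x : V) := 2 * ramp t x * phi x + 2 * ramp t x * x ord0 j * partial j phi x.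
have crp : continuous (fun x : V => 2 * ramp t x * phi x).
  move=> x; apply: (@continuousM _ _ (fun x => 2 * ramp t x)).
    exact: continuous_double_ramp.
  exact: test_continuous tphi x.
have c1 : continuous g1'.
  move=> x.
  apply: (@continuousB _ _ _ (fun x => ramp t x ^+ 2 * partial ord0 phi x)).
    apply: (@continuousM _ _ (fun x => ramp t x ^+ 2)).
      exact: continuous_sqr_ramp.
    exact: test_partial_continuous tphi _ x.
  exact: crp.
have c2 : continuous g2'.
  move=> x; apply: (@continuousD _ _ _ (fun x => 2 * ramp t x * phi x)).
    exact: crp.
  apply: (@continuousM _ _ (fun x : V => 2 * ramp t x * x ord0 j)).
    exact: continuous_ramp_coor.
  exact: test_partial_continuous tphi _ x.
have dg1 x : is_derive x (delta_mx ord0 ord0) g1 (g1' x).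
  have d1 := is_derive_sqr_ramp t x; have d2 := dphi ord0 x.
  by apply: is_derive_eq; rewrite scalerN [phi x *: _]mulrC.
have dg2 x : is_derive x (delta_mx ord0 j) g2 (g2' x).
  have d1 := is_derive_ramp t x j0; have d2 := dphi j x.
  have d3 := is_derive_coor x j j.
  apply: is_derive_eq; rewrite eqxx !scaler0 addr0 addrC /g2'; congr (_ + _).
  by rewrite [LHS]mulrC; congr (_ * _); exact: mulr1.
have o1 x : ~ Omega x \/ t <= x ord0 ord0 -> g1 x = 0.
  by rewrite /g1 => -[/(test_out tphi) ->|/ramp0 ->]; rewrite ?expr0n ?mulr0 ?mul0r.
have o1' x : ~ Omega x \/ t <= x ord0 ord0 -> g1' x = 0.
  rewrite /g1' => -[Ox|/ramp0 ->]; last by rewrite expr0n mulr0 !mul0r subr0.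
  by rewrite (test_out tphi)// (test_partial_out tphi)// !mulr0 subr0.
have o2 x : ~ Omega x \/ t <= x ord0 ord0 -> g2 x = 0.
  by rewrite /g2 => -[/(test_out tphi) ->|/ramp0 ->]; rewrite ?mulr0 ?mul0r.
have o2' x : ~ Omega x \/ t <= x ord0 ord0 -> g2' x = 0.
  rewrite /g2' => -[Ox|/ramp0 ->]; last by rewrite mulr0 !mul0r addr0.
  by rewrite (test_out tphi)// (test_partial_out tphi)// !mulr0 addr0.
have E1 := integral_cusp_below0 m_ge1 t_le1 t_delta Omega_cusp c1 dg1 o1 o1'.
have E2 := integral_cusp_below0 m_ge1 t_le1 t_delta Omega_cusp c2 dg2 o2 o2'.
have i1 := integrable_cusp_below m_ge1 Omega_open t_le1 t_delta Omega_cusp c1 o1'.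
have i2 := integrable_cusp_below m_ge1 Omega_open t_le1 t_delta Omega_cusp c2 o2'.
rewrite -[RHS](adde0 0%E) -{1}E1 -E2 -(integralD_EFin mD i1 i2).
by apply: eq_integral => x _; rewrite -EFinD /g1' /g2'; congr EFin; ring.
Qed.

End test.
End identities.

(** * Flux estimates for a Sobolev field *)

Section volume.
Context {R : realType} {n : nat}.
Local Notation V := 'rV[R]_n.+1.
Local Notation leb := (@lebesgue_rV R n.+1).
Variables (m t : R).
Hypotheses (m_ge0 : 0 <= m) (t_gt0 : 0 < t).
Local Notation D := (@cusp_below R n m t).

Definition axial_box (lo hi r : R) : set V :=
  box (fun i => if i == ord0 then lo else - r) (fun i => if i == ord0 then hi else r).

Lemma lebesgue_axial_box lo hi r : lo <= hi -> 0 <= r ->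
  leb (axial_box lo hi r) = ((hi - lo) * (2 * r) ^+ n)%:E.
Proof.
move=> lohi r0; rewrite lebesgue_rV_box => [|i]; last first.
  by case: ifP => // _; rewrite (ge0_cp r0).
rewrite big_ord_recl /= (eq_bigr (fun=> 2 * r)) => [|i _]; last first.
  by rewrite opprK mulr_natl mulr2n.
by rewrite prodr_const card_ord.
Qed.

Lemma cusp_below_volume : measurable D -> (leb D <= (t * (2 * t `^ m) ^+ n)%:E)%E.
Proof.
move=> mD.
have <- : leb (axial_box 0 t (t `^ m)) = (t * (2 * t `^ m) ^+ n)%:E.
  by rewrite lebesgue_axial_box ?powR_ge0 ?ltW// subr0.
apply: le_measure; rewrite ?inE//; first exact: measurable_box.
move=> x Dx i; case: ifPn => [/eqP ->|i0].
  by case: Dx => -[/= /ltW -> _ /ltW ->].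
rewrite -ler_norml (le_trans (ltW (cusp_below_coor Dx i0)))//.
case: Dx => -[/= x0 _ xt].
by apply: ge0_ler_powR => //; rewrite ?nnegrE; apply: ltW.
Qed.

(** A box in the cusp on which x_1 is comparable to [t], and whose volume is
    comparable to that of [cusp_below m t]; the factor [n.+1] makes up for the
    passage from the single transverse coordinates to their Euclidean norm. *)
Definition core : set V := axial_box (t / 4) (t / 2) ((t / 4) `^ m / n.+1%:R).

Lemma core_sub : core `<=` D.
Proof.
set r := (t / 4) `^ m / n.+1%:R.
have t4 : 0 < t / 4 by rewrite divr_gt0.
have r0 : 0 < r by rewrite divr_gt0// powR_gt0.
move=> x cx; have /andP[xl xu] := cx ord0; rewrite eqxx in xl xu.
have x0 : 0 < x ord0 ord0 by exact: lt_le_trans xl.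
split; last by rewrite /= (le_lt_trans xu)// ltr_pdivrMr// ltr_pMr// ltr1n.
split => //.
apply: (@lt_le_trans _ _ ((t / 4) `^ m)); last first.
  by apply: ge0_ler_powR => //; rewrite nnegrE ltW.
rewrite -[ltRHS]gtr0_norm ?powR_gt0// -sqrtr_sqr ltr_sqrt; last first.
  by rewrite exprn_gt0// powR_gt0.
have -> : (t / 4) `^ m = n.+1%:R * r by rewrite [RHS]mulrC divfK// pnatr_eq0.
apply: (@le_lt_trans _ _ (\sum_(i < n.+1 | i != ord0) r ^+ 2)).
  apply: ler_sum => i i0; have := cx i; rewrite (negbTE i0) => xi.
  by rewrite -[leLHS]real_normK ?num_real// lerXn2r ?nnegrE ?(ltW r0)// ler_norml.
apply: (@lt_le_trans _ _ (n.+1%:R * r ^+ 2)).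
  rewrite [ltRHS](_ : _ = \sum_(i < n.+1) r ^+ 2).
    by rewrite [ltRHS](bigD1 ord0)//= ltrDr exprn_gt0.
  by rewrite sumr_const card_ord mulr_natl.
rewrite [leRHS]exprMn ler_wpM2r ?exprn_ge0 ?(ltW r0)//.
by rewrite expr2 ler_peMl// ?ler0n// ler1n.
Qed.

Lemma core_volume : leb core =
  (t / 4 * (2 * ((t / 4) `^ m / n.+1%:R)) ^+ n)%:E.
Proof.
rewrite lebesgue_axial_box; first by congr (_ * _)%:E; field.
  by rewrite ler_pM2l// lef_pV2 ?posrE// ler_nat.
by rewrite divr_ge0// powR_ge0.
Qed.

End volume.

Section field.
Context {R : realType} {n : nat}.
Local Notation V := 'rV[R]_n.+1.
Local Notation leb := (@lebesgue_rV R n.+1).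
Variables (p q m delta t : R) (Omega : set V).
Hypotheses (p_gt0 : 0 < p) (q_gt0 : 0 < q) (pq : p^-1 + q^-1 = 1).
Hypotheses (m_ge1 : 1 <= m) (Omega_open : open Omega) (t_gt0 : 0 < t)
  (t_le1 : t <= 1) (t_delta : 2 * t < delta).
Hypothesis Omega_cusp :
  Omega `&` euclid_ball0 delta = cusp m `&` euclid_ball0 delta.
Variables (U : 'I_n.+1 -> V -> R) (DU : 'I_n.+1 -> 'I_n.+1 -> V -> R).
Hypothesis fieldU : W1p0_field Omega p U DU.
Variables (j : 'I_n.+1) (j0 : j != ord0).
Local Notation D := (@cusp_below R n m t).

Let mD : measurable D.
Proof.
exact: (cusp_below_measurable m_ge1 Omega_open t_le1 t_delta Omega_cusp).
Qed.

Let mOmega : measurable Omega. Proof. exact: open_measurable_rV. Qed.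

Let DOmega : D `<=` Omega.
Proof. exact: (cusp_below_sub m_ge1 t_le1 t_delta Omega_cusp). Qed.

Let Doo : (leb D < +oo)%E.
Proof.
apply: le_lt_trans (ltry _).
by apply: cusp_below_volume => //; exact: le_trans m_ge1.
Qed.

Let ramp_le x : D x -> ramp t x <= t.
Proof.
by move=> [[x0 _] xt]; rewrite rampE// gerBl ltW.
Qed.

Let ramp2_le x : D x -> `|ramp t x ^+ 2| <= 2.
Proof.
move=> Dx; rewrite ger0_norm ?sqr_ge0//.
apply: (@le_trans _ _ 1); last by rewrite ler1n.
by rewrite exprn_ile1 ?ramp_ge0// (le_trans (ramp_le Dx)).
Qed.

Let rampx_le x : D x -> `|2 * ramp t x * x ord0 j| <= 2 * t * t `^ m.
Proof.
move=> Dx; rewrite normrM ger0_norm ?mulr_ge0 ?ramp_ge0//.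
apply: ler_pM => //; rewrite ?mulr_ge0 ?ramp_ge0//.
  by rewrite ler_pM2l// ramp_le.
rewrite (le_trans (ltW (cusp_below_coor Dx j0)))//.
case: Dx => -[/= x0 _ xt].
apply: ge0_ler_powR; rewrite ?nnegrE ?(le_trans _ m_ge1)//; exact: ltW.
Qed.

Let rampx_le2 x : D x -> `|2 * ramp t x * x ord0 j| <= 2.
Proof.
move=> Dx; apply: le_trans (rampx_le Dx) _.
have : t `^ m <= 1.
  rewrite -(powRr0 t); apply: ger_powR; first by rewrite t_gt0.
  exact: le_trans m_ge1.
move=> tm; rewrite -[leRHS]mulr1; apply: ler_pM => //.
- by rewrite mulr_ge0// ltW.
- exact: powR_ge0.
- by rewrite -[leRHS]mulr1 ler_pM2l.
Qed.

Let iDU k l : leb.-integrable D (EFin \o DU k l).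
Proof. exact: (W1p0_integrable mD DOmega Doo p_gt0 q_gt0 pq (fieldU k)). Qed.

Let iramp2 (h : V -> R) : leb.-integrable D (EFin \o h) ->
  leb.-integrable D (EFin \o (fun x => ramp t x ^+ 2 * h x)).
Proof.
apply: (integrable_weight mD _ ramp2_le).
by apply: continuous_measurable_rV; exact: continuous_sqr_ramp.
Qed.

Let irampx (h : V -> R) : leb.-integrable D (EFin \o h) ->
  leb.-integrable D (EFin \o (fun x => 2 * ramp t x * x ord0 j * h x)).
Proof.
apply: (integrable_weight mD _ rampx_le2).
by apply: continuous_measurable_rV; exact: continuous_ramp_coor.
Qed.

Lemma field_transverse i : i != ord0 ->
  (\int[leb]_(x in D) (ramp t x ^+ 2 * DU i i x)%:E = 0)%E.
Proof.
move=> i0.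
have := @W1p0_limit _ _ Omega D p q (U i) (DU i) mD DOmega Doo p_gt0 q_gt0 pq
  mOmega (fieldU i) 2 (fun x => ramp t x ^+ 2) (cst 0) i i
  (@continuous_sqr_ramp _ _ t)
  (@cst_continuous _ _ _) ramp2_le.
under [X in _ -> _ -> X = _]eq_integral do rewrite mul0r addr0.
apply.
  by move=> x _; rewrite normr0.
move=> phi tphi; under eq_integral do rewrite mul0r addr0.
exact: (test_transverse m_ge1 t_le1 t_delta Omega_cusp tphi i0).
Qed.

Lemma field_axial : (\int[leb]_(x in D)
  (ramp t x ^+ 2 * DU ord0 ord0 x + 2 * ramp t x * x ord0 j * DU ord0 j x)%:E = 0)%E.
Proof.
apply: (@W1p0_limit _ _ Omega D p q (U ord0) (DU ord0) mD DOmega Doo p_gt0 q_gt0 pq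
  mOmega (fieldU ord0) 2 (fun x => ramp t x ^+ 2)
  (fun x => 2 * ramp t x * x ord0 j) ord0 j (@continuous_sqr_ramp _ _ t)
  (@continuous_ramp_coor _ _ t j) ramp2_le rampx_le2).
move=> phi tphi.
exact: (test_axial m_ge1 Omega_open t_le1 t_delta Omega_cusp tphi j0).
Qed.

(** The transverse components contribute nothing. *)
Lemma field_divergence : (\int[leb]_(x in D) (ramp t x ^+ 2 * divergence DU x)%:E =
  - \int[leb]_(x in D) (2 * ramp t x * x ord0 j * DU ord0 j x)%:E)%E.
Proof.
have i00 := iramp2 (iDU ord0 ord0).
have i0j := irampx (iDU ord0 j).
have := field_axial; under eq_integral do rewrite EFinD.
rewrite (integralD_EFin mD i00 i0j) => H.
have fin0j := integrable_fin_num mD i0j.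
transitivity (\int[leb]_(x in D) (ramp t x ^+ 2 * DU ord0 ord0 x)%:E)%E; last first.
  by rewrite -[LHS]adde0 -(subee fin0j) addeA H add0e.
transitivity (\int[leb]_(x in D) \sum_(i < n.+1) (ramp t x ^+ 2 * DU i i x)%:E)%E.
  apply: eq_integral => x _; rewrite sumEFin; congr EFin.
  by rewrite /divergence mulr_sumr.
rewrite integral_sum//= => [|i]; last exact: iramp2 (iDU i i).
rewrite (bigD1 ord0)//= big1 ?adde0// => i i0.
exact: field_transverse.
Qed.

(** The factor [t `^ m] bounds |x_j|: it is the width of the sections, as in
    Poincare's inequality. *)
Lemma divergence_le :
  (\int[leb]_(x in D) (ramp t x ^+ 2 * divergence DU x)%:E <=
   (2 * t * t `^ m)%:E * ('N[leb]_p%:E[EFin \o (DU ord0 j \_ Omega \_ D)] *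
     leb D `^ q^-1))%E.
Proof.
rewrite field_divergence.
have i0j := irampx (iDU ord0 j).
have C0 : 0 <= 2 * t * t `^ m by rewrite !mulr_ge0 ?powR_ge0// ltW.
apply: (@le_trans _ _
  `|\int[leb]_(x in D) (2 * ramp t x * x ord0 j * DU ord0 j x)%:E|%E).
  by rewrite -abseN; exact: lee_abs.
apply: le_trans (le_abse_integral leb mD (measurable_int _ i0j)) _.
apply: (@le_trans _ _ (\int[leb]_(x in D)
    ((2 * t * t `^ m)%:E * `|(DU ord0 j x)%:E|))%E).
  apply: ge0_le_integral => //.
  - by apply: measurableT_comp => //; exact: measurable_int i0j.
  - apply: emeasurable_funM => //.
    by apply: measurableT_comp => //; exact: measurable_int (iDU _ _).
  - move=> x Dx; rewrite /= lee_fin normrM.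
    by rewrite ler_wpM2r// rampx_le.
rewrite ge0_integralZl//; first last.
- by apply: measurableT_comp => //; exact: measurable_int (iDU _ _).
apply: lee_wpmul2l; first by rewrite lee_fin.
have mg : measurable_fun setT (DU ord0 j \_ Omega).
  by have [[_ /(_ j)[/sub_Lfun_mfun/set_mem]]] := fieldU ord0.
have := @integral_le_Lnorm _ _ _ leb D p q (DU ord0 j \_ Omega \_ D)
  mD _ p_gt0 q_gt0 pq.
rewrite (@eq_integral _ _ _ _ D (fun x => `|(DU ord0 j x)%:E|)%E).
  apply; apply/(measurable_restrictT _ mD); exact: measurable_funTS.
by move=> x xD; rewrite !patchE xD mem_set//; exact/DOmega/set_mem.
Qed.

(** The divergence is nonnegative almost everywhere on the end of the cusp, so the
    integral can be restricted to [core], where x_1 is between t / 4 and t / 2. *)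
Lemma divergence_ge (c alpha : R) : 0 < c ->
  {ae leb, forall x, D x -> c * x ord0 ord0 `^ alpha <= divergence DU x} ->
  ((((t / 2) ^+ 2 * (c * (4^-1 `^ `|alpha| * t `^ alpha)))%:E * leb (core m t) <=
   \int[leb]_(x in D) (ramp t x ^+ 2 * divergence DU x)%:E)%E).
Proof.
move=> c0 aeD; set C := _ * _.
have C0 : 0 <= C by rewrite !mulr_ge0 ?sqr_ge0 ?powR_ge0// ltW.
have idiv : leb.-integrable D (EFin \o (fun x => ramp t x ^+ 2 * divergence DU x)).
  apply: iramp2; have := @integrable_sum _ _ _ leb D mD _ (index_enum 'I_n.+1) xpredT
    (fun i => EFin \o DU i i) (fun i _ => iDU i i).
  by apply: eq_integrable => // x _; rewrite /= /divergence sumEFin.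
have mdiv := measurable_int _ idiv.
have mcore : measurable (core m t : set V) := @measurable_box _ _ _ _.
have -> : (\int[leb]_(x in D) (ramp t x ^+ 2 * divergence DU x)%:E =
    \int[leb]_(x in D) `|(ramp t x ^+ 2 * divergence DU x)%:E|)%E.
  apply: ae_eq_integral => //; first exact: measurableT_comp.
  apply: filterS aeD => x xdiv Dx; rewrite gee0_abs// lee_fin.
  rewrite mulr_ge0 ?sqr_ge0// (le_trans _ (xdiv Dx))// mulr_ge0 ?powR_ge0//.
  exact: ltW.
have -> : (C%:E * leb (core m t) = \int[leb]_(x in D) (C * \1_(core m t) x)%:E)%E.
  under eq_integral do rewrite EFinM.
  rewrite ge0_integralZl//.
    rewrite integral_indic// setIidl//.
    by apply: core_sub => //; exact: le_trans m_ge1.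
  by apply/measurable_EFinP; exact: measurable_indic.
apply: ae_ge0_le_integral => //.
- by move=> x _; rewrite lee_fin mulr_ge0.
- by apply/measurable_EFinP; apply: measurable_funM => //; exact: measurable_indic.
- exact: measurableT_comp.
apply: filterS aeD => x xdiv Dx; rewrite /= lee_fin indicE.
case: (boolP (x \in _)) => [/set_mem cx|_]; last by rewrite mulr0.
rewrite mulr1 (le_trans _ (ler_norm _))//.
rewrite {xdiv}(le_trans _ (ler_wpM2l (sqr_ge0 _) (xdiv Dx)))//.
have /andP[xl xu] := cx ord0; rewrite eqxx in xl xu.
have x0 : 0 < x ord0 ord0 by rewrite (lt_le_trans _ xl)// divr_gt0.
apply: ler_pM; rewrite ?sqr_ge0//.
- by rewrite mulr_ge0 ?(ltW c0)// mulr_ge0 ?powR_ge0.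
- rewrite ler_pXn2r// ?nnegrE ?ramp_ge0 ?divr_ge0 ?(ltW t_gt0)//.
  by rewrite rampE; [lra|case: Dx].
rewrite ler_pM2l//; pose y := x ord0 ord0 / t.
have y0 : 0 < y by rewrite divr_gt0.
have -> : x ord0 ord0 = y * t by rewrite divfK// gt_eqF.
rewrite powRM ?(ltW y0) ?(ltW t_gt0)// ler_wpM2r ?powR_ge0//.
(* As y <= 1, the exponent `|alpha| gives a lower bound whatever the sign of alpha. *)
apply: (@le_trans _ _ (y `^ `|alpha|)).
  apply: ge0_ler_powR; rewrite ?nnegrE ?invr_ge0 ?(ltW y0)//.
  by rewrite ler_pdivlMr// mulrC.
apply: ger_powR; last exact: ler_norm.
rewrite y0 ler_pdivrMr// mul1r (le_trans xu)// ler_pdivrMr// ler_peMr ?ltW//.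
by rewrite ltr1n.
Qed.

End field.

(** * Comparison of the powers of t *)

(** Both sides of the hypothesis are monomials in [t]; the exponents [e1] and [e2]
    satisfy [e1 <= e2] by the bound on [alpha], and [t <= 1]. *)
Lemma scaling_bound {R : realType} (n : nat) (p q m alpha b t nu : R) :
  0 < q -> p^-1 + q^-1 = 1 -> alpha <= (-1 - m * n%:R) / p + m - 1 ->
  0 < t -> t <= 1 -> 0 <= nu ->
  (t / 2) ^+ 2 * (b * t `^ alpha) * (t / 4 * (2 * ((t / 4) `^ m / n.+1%:R)) ^+ n) <=
    2 * t * t `^ m * (nu * (t * (2 * t `^ m) ^+ n) `^ q^-1) ->
  b / 16 * (2 * (4^-1 `^ m / n.+1%:R)) ^+ n <= 2 * (2 ^+ n) `^ q^-1 * nu.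
Proof.
move=> q0 pq alpha_le t0 t1 nu0.
have tn0 : t != 0 by rewrite gt_eqF.
have t0' : 0 <= t by exact: ltW.
pose e1 := 3 + alpha + m * n%:R; pose e2 := 1 + m + (1 + m * n%:R) * q^-1.
have e12 : e1 <= e2.
  have pE : p^-1 = 1 - q^-1 by lra.
  move: alpha_le; rewrite /e1 /e2 pE; move: (q^-1) => r; lra.
have tmn : (t `^ m) ^+ n = t `^ (m * n%:R) by rewrite -powR_mulrn ?powR_ge0// powRrM.
have powD r s : t `^ (r + s) = t `^ r * t `^ s by rewrite powRD// tn0 implybT.
have E1 : (t / 2) ^+ 2 * (b * t `^ alpha) *
    (t / 4 * (2 * ((t / 4) `^ m / n.+1%:R)) ^+ n) =
    b / 16 * (2 * (4^-1 `^ m / n.+1%:R)) ^+ n * t `^ e1.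
  rewrite powRM ?invr_ge0// (_ : 2 * (t `^ m * _ / _) =
    (2 * (4^-1 `^ m / n.+1%:R)) * t `^ m); last by ring.
  rewrite [X in _ * (_ * X)]exprMn tmn /e1 (powD (3 + alpha)) (powD 3).
  rewrite (powR_mulrn 3)//.
  by move: (_ ^+ n) (t `^ alpha) (t `^ (m * n%:R)) => X Y Z; field.
have E2 : 2 * t * t `^ m * (nu * (t * (2 * t `^ m) ^+ n) `^ q^-1) =
    2 * (2 ^+ n) `^ q^-1 * nu * t `^ e2.
  rewrite exprMn tmn powRM ?mulr_ge0 ?exprn_ge0 ?powR_ge0//.
  rewrite powRM ?exprn_ge0 ?powR_ge0// -powRrM /e2.
  rewrite (_ : (1 + m * n%:R) * q^-1 = q^-1 + m * n%:R * q^-1); last by ring.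
  rewrite (powD (1 + m)) (powD 1) powD powRr1//.
  by move: (_ `^ q^-1) => X; ring.
rewrite E1 E2 => le12.
have te1 : 0 < t `^ e1 by exact: powR_gt0.
rewrite -(ler_pM2r te1) (le_trans le12)// ler_wpM2l//.
  by rewrite !mulr_ge0 ?powR_ge0.
by apply: ger_powR => //; rewrite t0.
Qed.

(** * Nonexistence *)

(* The dimension is N = n.+1, so that N - 1 is n. *)
Theorem mainTheorem3 (R : realType) (n : nat) (p m alpha delta : R)
    (Omega : set 'rV[R]_n.+1) (f : 'rV[R]_n.+1 -> R)
    (N_ge3 : (3 <= n.+1)%N) (p_gt1 : 1 < p) (m_gt1 : 1 < m)
    (Omega_domain : domain Omega) (Omega_bounded : bounded_set Omega)
    (delta_gt0 : 0 < delta)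
    (Omega_cusp : Omega `&` euclid_ball0 delta = cusp m `&` euclid_ball0 delta)
    (alpha_gt : (-1 - m * n%:R) / p < alpha)
    (alpha_le : alpha <= (-1 - m * n%:R) / p + m - 1)
    (f_Lp : Lp_mean0 Omega p f)
    (f_asymp : asymp_first_coord0 Omega f (fun t => t `^ alpha)) :
  ~ exists (U : 'I_n.+1 -> 'rV[R]_n.+1 -> R)
           (DU : 'I_n.+1 -> 'I_n.+1 -> 'rV[R]_n.+1 -> R),
      W1p0_field Omega p U DU /\ ae_eq_on Omega (divergence DU) f.
Proof.
move=> [U [DU [fieldU divU]]].
have Omega_open := Omega_domain.1.
have j0 : (ord_max : 'I_n.+1) != ord0.
  by rewrite -val_eqE /= -lt0n; exact: ltnW N_ge3.
have m_ge1 := ltW m_gt1.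
have m_ge0 : 0 <= m by exact: le_trans m_ge1.
have p_gt0 : 0 < p by exact: lt_trans p_gt1.
pose q := (1 - p^-1)^-1.
have q_gt0 : 0 < q by rewrite invr_gt0 subr_gt0 invf_lt1.
have pq : p^-1 + q^-1 = 1 by rewrite invrK addrC subrK.
have [c c0 /(_ (c / 2))[|eta eta0 f_near]] := f_asymp; first by rewrite divr_gt0.
(* Below the height tau, the cusp lies in the balls of radii delta and eta. *)
pose tau := Num.min 1 (Num.min delta eta / 4).
have tau0 : 0 < tau by rewrite lt_min ltr01 divr_gt0// lt_min delta_gt0.
pose t k := tau / k.+1%:R.
have t0 k : 0 < t k by rewrite divr_gt0.
have t_tau k : t k <= tau by rewrite ler_pdivrMr// ler_peMr ?(ltW tau0)// ler1n.
have t1 k : t k <= 1 by rewrite (le_trans (t_tau k))// ge_min lexx.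
have t4 k : 4 * t k <= Num.min delta eta.
  rewrite mulrC -ler_pdivlMr// (le_trans (t_tau k))// ge_min.
  by rewrite lexx orbT.
have tdelta k : 2 * t k < delta.
  have : Num.min delta eta <= delta by rewrite ge_min lexx.
  by have := t4 k; have := t0 k; lra.
have teta k : 2 * t k <= eta.
  have : Num.min delta eta <= eta by rewrite ge_min lexx orbT.
  by have := t4 k; have := t0 k; lra.
pose D k : set 'rV[R]_n.+1 := cusp_below m (t k).
have mD k : measurable (D k).
  exact: (cusp_below_measurable m_ge1 Omega_open (t1 k) (tdelta k) Omega_cusp).
have D0 x : \forall k \near \oo, ~ D k x.
  have [x0|x0] := leP (x ord0 ord0) 0.
    by apply: nearW => k [[/=]]; rewrite ltNge x0.
  exists (Num.truncn (tau / x ord0 ord0)) => // k /= Kk [_ /=].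
  apply/negP; rewrite -leNgt ler_pdivrMr// mulrC -ler_pdivrMr//.
  by rewrite (le_trans (ltW (truncnS_gt _)))// ler_nat.
pose j : 'I_n.+1 := ord_max.
have [/sub_Lfun_mfun/set_mem mg /sub_Lfun_finLfun/set_mem goo] :
    Lp Omega p (DU ord0 j) /\ Lp Omega p (DU ord0 j).
  by have [[_ /(_ j)[]]] := fieldU ord0.
(* The two constants of [scaling_bound]: k1 <= k2 * N is to be contradicted. *)
pose k1 := c / 2 * 4^-1 `^ `|alpha| / 16 * (2 * (4^-1 `^ m / n.+1%:R)) ^+ n.
pose k2 : R := 2 * (2 ^+ n) `^ q^-1.
have k10 : 0 < k1.
  by rewrite !(mulr_gt0, exprn_gt0, divr_gt0, powR_gt0, invr_gt0).
have k20 : 0 < k2 by rewrite mulr_gt0// powR_gt0// exprn_gt0.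
have [k Nk] := filter_ex
  (Lnorm_vanishing p_gt0 mg goo mD D0 (divr_gt0 k10 k20)).
have aeD : {ae lebesgue_rV n.+1, forall x, D k x ->
    c / 2 * x ord0 ord0 `^ alpha <= divergence DU x}.
  apply: filterS2 f_near divU => x fx divx Dx.
  have Ox := cusp_below_sub m_ge1 (t1 k) (tdelta k) Omega_cusp Dx.
  have xeta : euclid_norm x < eta.
    by rewrite (lt_le_trans _ (teta k))// (cusp_below_norm m_ge1 (t1 k) Dx).
  have x0 : 0 < x ord0 ord0 `^ alpha by apply: powR_gt0; case: Dx => -[].
  rewrite (divx Ox) -ler_pdivlMr//.
  by have := fx (conj Ox xeta); rewrite ler_norml => /andP[+ _]; lra.
have c20 : 0 < c / 2 by rewrite divr_gt0.
have lower := divergence_ge p_gt0 q_gt0 pq m_ge1 Omega_open (t0 k) (t1 k)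
  (tdelta k) Omega_cusp fieldU c20 aeD.
have upper := divergence_le p_gt0 q_gt0 pq m_ge1 Omega_open (t0 k) (t1 k)
  (tdelta k) Omega_cusp fieldU j0.
have := le_trans lower upper.
rewrite core_volume// -EFinM => le1.
have vol := cusp_below_volume m_ge0 (t0 k) (mD k).
set N := ('N[_]_p%:E[_])%E in le1 Nk.
have N0 : (0 <= N)%E by exact: Lnorm_ge0.
have Nfin : N \is a fin_num by rewrite ge0_fin_numE// (lt_trans Nk)// ltry.
have C0 : 0 <= 2 * t k * t k `^ m by rewrite !mulr_ge0 ?powR_ge0// ltW.
have V0 : 0 <= t k * (2 * t k `^ m) ^+ n.
  by rewrite mulr_ge0 ?exprn_ge0 ?mulr_ge0 ?powR_ge0// ltW.
have volq : (lebesgue_rV n.+1 (D k) `^ q^-1 <=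
    ((t k * (2 * t k `^ m) ^+ n) `^ q^-1)%:E)%E.
  rewrite -poweR_EFin; apply: gt0_ler_poweR => //.
  - by rewrite invr_ge0 ltW.
  - by rewrite in_itv/= measure_ge0 leey.
  - by rewrite in_itv/= leey lee_fin V0.
have {le1 volq} := le_trans le1 (lee_wpmul2l _ (lee_wpmul2l N0 volq)).
rewrite lee_fin C0 => /(_ isT).
rewrite -(fineK Nfin) -!EFinM lee_fin (mulrA (c / 2)) => le2.
have nu0 : 0 <= fine N by rewrite fine_ge0.
have := scaling_bound q_gt0 pq alpha_le (t0 k) (t1 k) nu0 le2.
rewrite -/k1 -/k2 leNgt => /negP; apply.
by rewrite mulrC -ltr_pdivlMr// -lte_fin fineK.
Qed.
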